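(* Let $k\ge 3$ be an integer and let $a,b$ be real numbers such that $\psi_k(G) \le a\,|V(G)|+b\,|E(G)|$ holds for all graphs $G$. Suppose further that the real numbers $q,w>0$ and the integer $x>0$ satisfy the following inequalities: $$w\le 2q , \qquad a+qx < 1 , \qquad w \le \frac{(a+b-1)+(q+b)x}{x+1} .$$ Then $\psi_k(G) \le a'\,|V(G)|+b'\,|E(G)|$ also holds for every graph $G$ with the values $$a' = a+qx , \qquad b' = b-w .$$
   Context: Graphs are finite, simple and undirected. $P_k$ denotes the path with $k$ vertices. A $k$-path vertex cover of $G$ is a set $T\subseteq V(G)$ such that $G-T$ contains no (not necessarily induced) subgraph isomorphic to $P_k$. $\psi_k(G)$ is the minimum cardinality of a $k$-path vertex cover of $G$. *)

(* Defs.v *)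
From HB Require Import structures.
From mathcomp Require Import all_boot all_order all_algebra.
From mathcomp Require Import boolp reals.
Set Implicit Arguments.
Unset Strict Implicit.
Unset Printing Implicit Defensive.

Record sgraph := SGraph {
  vertex :> finType;
  adj : rel vertex;
  adj_sym : symmetric adj;
  adj_irrefl : irreflexive adj
}.

Definition edges (G : sgraph) : {set {set G}} :=
  [set e : {set G} | [exists u, exists v, adj u v && (e == [set u; v])]].

Definition isomorphic (G H : sgraph) : Prop :=
  exists f : G -> H, bijective f /\ forall u v, adj (f u) (f v) = adj u v.

Section Subgraph.
Variables (G : sgraph) (S : {set G}) (F : {set {set G}}).

Definition subgraph_adj : rel {u : G | u \in S} :=
  fun u v => adj (val u) (val v) && ([set val u; val v] \in F).

Lemma subgraph_adj_sym : symmetric subgraph_adj.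
Proof. by move=> u v; rewrite /subgraph_adj adj_sym setUC. Qed.

Lemma subgraph_adj_irrefl : irreflexive subgraph_adj.
Proof. by move=> u; rewrite /subgraph_adj adj_irrefl. Qed.

(* Vertex set S; the edges are those edges of G that lie in F and have both
   ends in S.  No constraint on F is needed: as S and F vary, this ranges over
   exactly the subgraphs of G. *)
Definition subgraph : sgraph := SGraph subgraph_adj_sym subgraph_adj_irrefl.
End Subgraph.

(* G - T *)
Definition del_vertices (G : sgraph) (T : {set G}) : sgraph :=
  subgraph (~: T) (edges G).

Section PathGraph.
Variable k : nat.

Definition path_adj : rel 'I_k :=
  fun i j => (i.+1 == j :> nat) || (j.+1 == i :> nat).

Lemma path_adj_sym : symmetric path_adj.
Proof. by move=> i j; rewrite /path_adj orbC. Qed.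

Lemma path_adj_irrefl : irreflexive path_adj.
Proof. by move=> i; rewrite /path_adj orbb gtn_eqF. Qed.

(* P_k: k counts the vertices, not the edges. *)
Definition path_graph : sgraph := SGraph path_adj_sym path_adj_irrefl.
End PathGraph.

Definition path_vertex_cover (k : nat) (G : sgraph) (T : {set G}) : Prop :=
  ~ exists (S : {set del_vertices T}) (F : {set {set del_vertices T}}),
      isomorphic (subgraph S F) (path_graph k).

(* For k > 0 the full vertex set is a cover, so the minimum is attained
   (psi_spec); psi 0 G is a junk value. *)
Definition psi (k : nat) (G : sgraph) : nat :=
  #|[arg min_(T < [set: G] | `[< path_vertex_cover k T >]) #|T| ]|.

Lemma path_vertex_coverT (k : nat) (G : sgraph) :
  0 < k -> path_vertex_cover k [set: G].
Proof.
case: k => // k _ [S [F [f [[g _ _] _]]]].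
by case: (val (g ord0)) => u; rewrite setCT inE.
Qed.

Lemma psi_spec (k : nat) (G : sgraph) : 0 < k ->
  (exists2 T : {set G}, path_vertex_cover k T & #|T| = psi k G) /\
  (forall T : {set G}, path_vertex_cover k T -> psi k G <= #|T|).
Proof.
move=> k0; rewrite /psi; case: arg_minnP => [|T /asboolP hT minT].
  exact/asboolP/path_vertex_coverT.
by split=> [|U hU]; [exists T | apply/minT/asboolP].
Qed.

(* Main.v *)
Require Import Defs.
From mathcomp Require Import all_boot all_order all_algebra.
From mathcomp Require Import reals lra.
Import Order.TTheory GRing.Theory Num.Theory.
Local Open Scope ring_scope.

(** Argue by induction on the number of vertices, with a threshold on the
    degrees. Write a' = a + q x and b' = b - w.

    If some vertex v lies on more than x edges, delete it: adding v to a cover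
    of G - v gives a cover of G ([psi_del_vertex]), so the left-hand side grows
    by at most 1 when v is put back, while the right-hand side grows by at
    least a' + b' (x + 1) ([card_del_vertex], [card_edges_del_vertex]). The
    inequality a' + b' (x + 1) >= 1 is the third hypothesis with its
    denominator cleared; together with a' < 1 it also forces b' > 0, which is
    why a vertex of degree larger than x + 1 is at least as good.

    If every vertex lies on at most x edges, then 2 |E| <= x |V| by double
    counting ([handshake]), hence w |E| <= 2 q |E| <= q x |V|: what the new
    bound loses on edges it regains on vertices, so it follows from the old
    one. *)

Lemma mem_edges (G : sgraph) (u v : G) : ([set u; v] \in edges G) = adj u v.
Proof.
rewrite inE; apply/existsP/idP => [[s /existsP[t /andP[st /eqP uvst]]] | uv].
  have su : s \in [set u; v] by rewrite uvst set21.
  have tu : t \in [set u; v] by rewrite uvst set22.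
  move: su tu st; rewrite !inE.
  by case/orP=> /eqP-> /orP[]/eqP->; rewrite ?adj_irrefl // adj_sym.
by exists u; apply/existsP; exists v; rewrite uv eqxx.
Qed.

Lemma edgesP (G : sgraph) (e : {set G}) :
  reflect (exists u v : G, adj u v /\ e = [set u; v]) (e \in edges G).
Proof.
apply: (iffP idP) => [|[u [v [uv ->]]]]; last by rewrite mem_edges.
by rewrite inE => /existsP[u /existsP[v /andP[uv /eqP->]]]; exists u, v.
Qed.

Lemma card_edge (G : sgraph) (e : {set G}) : e \in edges G -> #|e| = 2%N.
Proof.
case/edgesP=> u [v [uv ->]]; rewrite cards2.
by case: eqVneq uv => // ->; rewrite adj_irrefl.
Qed.

Definition incident_edges {G : sgraph} (v : G) : {set {set G}} :=
  [set e in edges G | v \in e].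

Lemma handshake (G : sgraph) :
  (\sum_(v : G) #|incident_edges v| = 2 * #|edges G|)%N.
Proof.
transitivity (\sum_(v : G) \sum_(e in edges G) (v \in e : nat))%N.
  apply: eq_bigr => v _; rewrite -sum1_card -big_mkcondr /=.
  by apply: eq_bigl => e; rewrite inE.
rewrite exchange_big /= mulnC -sum_nat_const; apply: eq_bigr => e /card_edge <-.
by rewrite -big_mkcond /= sum1_card.
Qed.

(** A copy of H in G is the image of an injective homomorphism, equipped with
    the images of the edges of H only; this replaces nested subgraph types by
    plain maps, which compose with vertex deletion. *)
Lemma subgraph_isomorphicP (G H : sgraph) :
  (exists (S : {set G}) (F : {set {set G}}), isomorphic (subgraph S F) H) <->
  (exists2 f : H -> G, injective f & {homo f : u v / adj u v}).
Proof.
split=> [[S [F [f [[g fK gK] f_adj]]]] | [f f_inj f_adj]].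
  exists (val \o g) => [|u v uv]; first exact: inj_comp val_inj (can_inj gK).
  have: adj (g u) (g v) by rewrite -f_adj !gK.
  by case/andP.
pose F := [set f @: (e : {set H}) | e in edges H].
have fS (u : H) : f u \in f @: [set: H] by rewrite imset_f ?inE.
pose h (u : H) : subgraph (f @: [set: H]) F := Sub (f u) (fS u).
have h_inj : injective h by move=> u v /(congr1 val) /f_inj.
have h_onto y : exists u, h u == y.
  by case/imsetP: (valP y) => u _ yu; exists u; apply/eqP/val_inj.
(* The isomorphism runs from the copy to H, so it is the inverse of h. *)
pose g y := xchoose (h_onto y).
have gK : cancel g h by move=> y; apply/eqP/(xchooseP (h_onto y)).
have hK : cancel h g by move=> u; apply: h_inj; rewrite gK.
exists (f @: [set: H]), F, g; split; first by exists h.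
move=> y z; rewrite -{2}(gK y) -{2}(gK z).
rewrite [RHS]/= /subgraph_adj /=.
have -> : [set f (g y); f (g z)] = f @: [set g y; g z].
  by rewrite imsetU1 imset_set1.
rewrite (mem_imset _ _ (imset_inj f_inj)) mem_edges.
by apply/idP/andP => [yz|[]//]; split=> //; apply: f_adj.
Qed.

Lemma del_vertices_adj (G : sgraph) (T : {set G}) (u v : del_vertices T) :
  adj u v = adj (val u) (val v).
Proof. by rewrite /= /subgraph_adj mem_edges andbb. Qed.

(** If T covers G - v then v together with T covers G: a k-path of G that
    avoids both is a k-path of G - v that avoids T. *)
Lemma psi_del_vertex (k : nat) (G : sgraph) (v : G) :
  (0 < k)%N -> (psi k G <= (psi k (del_vertices [set v])).+1)%N.
Proof.
move=> k_gt0.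
have [[T T_cover <-] _] := psi_spec (del_vertices [set v]) k_gt0.
have [_ psi_min] := psi_spec G k_gt0.
apply: (@leq_trans #|v |: val @: T|); last first.
  rewrite -add1n (leq_trans (leq_card_setU _ _)) // cards1 leq_add2l.
  exact: leq_imset_card.
apply: psi_min => /subgraph_isomorphicP[f f_inj f_adj]; apply: T_cover.
apply/subgraph_isomorphicP.
have fv i : val (f i) \in ~: [set v].
  by have := valP (f i); rewrite !inE negb_or => /andP[].
pose f1 i : del_vertices [set v] := Sub (val (f i)) (fv i).
have fT i : f1 i \in ~: T.
  have := valP (f i); rewrite !inE negb_or => /andP[_]; apply: contraNN => f1T.
  by apply/imsetP; exists (f1 i).
exists (fun i => Sub (f1 i) (fT i)) => [i j /(congr1 (val \o val)) /= ij|i j ij].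
  exact/f_inj/val_inj.
rewrite !del_vertices_adj /=.
by have := f_adj i j ij; rewrite del_vertices_adj.
Qed.

Lemma card_del_vertex (G : sgraph) (v : G) :
  #|G| = #|del_vertices [set v]|.+1.
Proof. by rewrite -(cardsC [set v]) cards1 card_sig. Qed.

Lemma card_edges_del_vertex (G : sgraph) (v : G) :
  (#|edges (del_vertices [set v])| + #|incident_edges v| <= #|edges G|)%N.
Proof.
have val_imset_inj : injective (fun e : {set del_vertices [set v]} => val @: e).
  exact/imset_inj/val_inj.
rewrite -(card_imset _ val_imset_inj) addnC.
rewrite /incident_edges setIdE -(cardsID [set e : {set G} | v \in e] (edges G)).
rewrite leq_add2l.
apply/subset_leq_card/subsetP => _ /imsetP[_ /edgesP[s [t [st ->]]] ->].
have:= valP s; have:= valP t; rewrite imsetU1 imset_set1 !in_setC !in_set1 => tv sv.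
rewrite in_setD inE mem_edges -del_vertices_adj st andbT in_set2.
by rewrite ![v == _]eq_sym negb_or sv tv.
Qed.

Lemma card_edges_bounded_degree (G : sgraph) (x : nat) :
  (forall v : G, (#|incident_edges v| <= x)%N) ->
  (2 * #|edges G| <= x * #|G|)%N.
Proof.
move=> deg_le; rewrite -handshake mulnC -sum_nat_const.
by apply: leq_sum => v _.
Qed.

Theorem theorem10 (R : realType) (k : nat) (hk : (3 <= k)%N) (a b : R)
  (hab : forall G : sgraph,
    (psi k G)%:R <= a * #|G|%:R + b * #|edges G|%:R)
  (q w : R) (x : nat) (hq : 0 < q) (hw : 0 < w) (hx : (0 < x)%N)
  (hwq : w <= 2 * q)
  (haq : a + q * x%:R < 1)
  (hwx : w <= ((a + b - 1) + (q + b) * x%:R) / (x%:R + 1)) :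
  forall G : sgraph,
    (psi k G)%:R <= (a + q * x%:R) * #|G|%:R + (b - w) * #|edges G|%:R.
Proof.
have x1_gt0 : 0 < x%:R + 1 :> R by rewrite ltr_wpDl.
have gain : 1 <= (a + q * x%:R) + (b - w) * (x%:R + 1).
  by move: hwx; rewrite ler_pdivlMr //; lra.
have b'_gt0 : 0 < b - w.
  by rewrite -(pmulr_lgt0 _ x1_gt0); lra.
move=> G; have [n] := ubnP #|G|; elim: n G => // n IHn G Gn.
have [v deg_gt|deg_le] := pickP (fun v : G => (x < #|incident_edges v|)%N).
  have IH := IHn (del_vertices [set v]).
  rewrite (card_del_vertex _ v) in Gn *; move/(_ Gn) in IH.
  have psi_le : (psi k G)%:R <= (psi k (del_vertices [set v]))%:R + 1 :> R.
    by rewrite natr1 ler_nat psi_del_vertex // (leq_trans _ hk).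
  have edges_ge :
      #|edges (del_vertices [set v])|%:R + (x%:R + 1) <= #|edges G|%:R :> R.
    rewrite natr1 -natrD ler_nat.
    by rewrite (leq_trans _ (card_edges_del_vertex _ v)) // leq_add2l.
  (* Multiplied by b' > 0, the lost edges become linear data: together with
     gain they pay for the vertex added to the cover. *)
  move: edges_ge; rewrite -(ler_pM2l b'_gt0) mulrDr -natr1; lra.
have edges_le : 2 * #|edges G|%:R <= x%:R * #|G|%:R :> R.
  rewrite -!natrM ler_nat card_edges_bounded_degree // => v.
  by rewrite leqNgt deg_le.
have w_le : w * #|edges G|%:R <= 2 * q * #|edges G|%:R by rewrite ler_wpM2r.
move: edges_le (hab G); rewrite -(ler_pM2l hq); lra.
Qed.
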